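(* Let $p_1,p_2,p_3,q_1,q_2,q_3\ge 2$ be integers and $G=\mathbb{Z}_{p_1q_1}\times\mathbb{Z}_{p_2q_2}\times\mathbb{Z}_{p_3q_3}$. Let $$A=\prod_{j=1}^{3}\Big\{0,\tfrac{1}{p_jq_j},\dots,\tfrac{p_j-1}{p_jq_j}\Big\}\subset G,\qquad S=\prod_{j=1}^{3}\{0,q_j,2q_j,\dots,(p_j-1)q_j\}\subset\widehat{G}.$$ Put $$L_1=\{0,q_1,\dots,(p_1-1)q_1\}\times\{q_2\}\times\{0\},\quad L_1'=\{1,q_1+1,\dots,(p_1-1)q_1+1\}\times\{q_2\}\times\{0\},$$ $$L_2=\{0\}\times\{0,q_2,\dots,(p_2-1)q_2\}\times\{q_3\},\quad L_2'=\{0\}\times\{1,q_2+1,\dots,(p_2-1)q_2+1\}\times\{q_3\},$$ $$L_3=\{q_1\}\times\{0\}\times\{0,q_3,\dots,(p_3-1)q_3\},\quad L_3'=\{q_1\}\times\{0\}\times\{1,q_3+1,\dots,(p_3-1)q_3+1\},$$ and $S'=\big(S\setminus(L_1\cup L_2\cup L_3)\big)\cup L_1'\cup L_2'\cup L_3'$. Then $S'$ is a spectrum of $A$; consequently the matrix $\big(e^{2\pi i\langle \mathbf{s},\mathbf{a}\rangle}\big)_{\mathbf{s}\in S',\,\mathbf{a}\in A}$ is a complex Hadamard matrix of order $p_1p_2p_3$.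
   Context: Elements of $\mathbb{Z}_{p_jq_j}$ are written as fractions $\frac{m}{p_jq_j}$, $0\le m\le p_jq_j-1$ (addition mod $1$), and elements of $G$ are vectors $\mathbf{g}=(g_1,g_2,g_3)$ of such fractions. Characters, i.e. elements of $\widehat{G}$, are identified with integer vectors $\mathbf{h}=(h_1,h_2,h_3)$, $0\le h_j\le p_jq_j-1$ (coordinates mod $p_jq_j$), acting by $\mathbf{g}\mapsto e^{2\pi i\langle\mathbf{h},\mathbf{g}\rangle}$ with $\langle\mathbf{h},\mathbf{g}\rangle=\sum_j h_jg_j$. A set $S\subset\widehat{G}$ is a spectrum of a finite set $T\subset G$ if the characters in $S$, restricted to $T$, form an orthogonal basis of $L^2(T)$; equivalently $|S|=|T|$ and $\sum_{\mathbf{t}\in T}e^{2\pi i\langle\mathbf{s}-\mathbf{s}',\mathbf{t}\rangle}=0$ for all distinct $\mathbf{s},\mathbf{s}'\in S$. A complex Hadamard matrix of order $r$ is an $r\times r$ complex matrix with all entries of absolute value $1$ and pairwise orthogonal rows. *)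

(* Defs.v *)
From mathcomp Require Import all_boot all_order all_algebra.
From mathcomp Require Import reals trigo.
From mathcomp Require Export complex.

Set Implicit Arguments.
Unset Strict Implicit.
Unset Printing Implicit Defensive.

Import Order.TTheory GRing.Theory Num.Theory.
Local Open Scope ring_scope.

(* An element (m1, m2, m3) of this type stands for the vector of fractions
   (m1/n1, m2/n2, m3/n3) mod 1 when seen in the group Z_n1 x Z_n2 x Z_n3, and
   for the integer vector (m1, m2, m3) mod (n1, n2, n3) when seen in its dual.
   'Z_n is Z/nZ only for n >= 2. *)
Notation Z3 n1 n2 n3 := ('Z_n1 * 'Z_n2 * 'Z_n3)%type.

Section Spectra.
Variables (R : realType) (n1 n2 n3 : nat).
Local Notation G := (Z3 n1 n2 n3).

(* <h, g>, on the representatives 0, ..., n_j - 1; determined modulo 1. *)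
Definition pairing (h g : G) : R :=
  (val h.1.1)%:R * ((val g.1.1)%:R / n1%:R)
  + (val h.1.2)%:R * ((val g.1.2)%:R / n2%:R)
  + (val h.2)%:R * ((val g.2)%:R / n3%:R).

Definition expi2pi (x : R) : R[i] :=
  Complex (cos (2 * pi * x)) (sin (2 * pi * x)).

Definition character (h g : G) : R[i] := expi2pi (pairing h g).

(* L^2(T) for the counting measure on T. *)
Definition L2space (T : {set G}) : vectType R[i] :=
  {ffun {t : G | t \in T} -> R[i]^o}.

Definition L2_dot (T : {set G}) (f g : L2space T) : R[i] :=
  \sum_(t : {t : G | t \in T}) f t * Num.conj (g t).

Definition restricted_character (T : {set G}) (h : G) : L2space T :=
  [ffun t => character h (val t)].

Definition is_spectrum (S T : {set G}) : Prop :=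
  basis_of (fullv : {vspace L2space T}) [seq restricted_character T s | s <- enum S]
  /\ (forall s s' : G, s \in S -> s' \in S -> s != s' ->
        L2_dot (restricted_character T s) (restricted_character T s') = 0).

Definition character_matrix (S T : {set G}) : 'M[R[i]]_(#|S|, #|T|) :=
  \matrix_(i, j) character (enum_val i) (enum_val j).

End Spectra.

Definition is_complex_hadamard (R : realType) (r : nat) (M : 'M[R[i]]_r) : Prop :=
  (forall i j, `|M i j| = 1)
  /\ (forall i i', i != i' -> \sum_j M i j * Num.conj (M i' j) = 0).

(* {a, a + d, ..., a + (p - 1) d} in Z/nZ *)
Definition progr (n a d p : nat) : {set 'Z_n} :=
  [set (a + k * d)%N%:R | k : 'I_p].

Definition box (n1 n2 n3 : nat) (X : {set 'Z_n1}) (Y : {set 'Z_n2})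
  (Z : {set 'Z_n3}) : {set Z3 n1 n2 n3} := setX (setX X Y) Z.

Section Sets.
Variables p1 p2 p3 q1 q2 q3 : nat.
Local Notation n1 := (p1 * q1)%N.
Local Notation n2 := (p2 * q2)%N.
Local Notation n3 := (p3 * q3)%N.
Local Notation G := (Z3 n1 n2 n3).

Definition setA : {set G} :=
  box (progr n1 0 1 p1) (progr n2 0 1 p2) (progr n3 0 1 p3).

Definition setS : {set G} :=
  box (progr n1 0 q1 p1) (progr n2 0 q2 p2) (progr n3 0 q3 p3).

Definition L1  : {set G} := box (progr n1 0 q1 p1) [set q2%:R] [set 0].
Definition L1' : {set G} := box (progr n1 1 q1 p1) [set q2%:R] [set 0].
Definition L2 : {set G} := box [set 0] (progr n2 0 q2 p2) [set q3%:R].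
Definition L2' : {set G} := box [set 0] (progr n2 1 q2 p2) [set q3%:R].
Definition L3  : {set G} := box [set q1%:R] [set 0] (progr n3 0 q3 p3).
Definition L3' : {set G} := box [set q1%:R] [set 0] (progr n3 1 q3 p3).

Definition setS' : {set G} :=
  (setS :\: (L1 :|: L2 :|: L3)) :|: L1' :|: L2' :|: L3'.

End Sets.

(* Main.v *)
Require Import Defs.
From mathcomp Require Import all_boot all_order all_algebra.
From mathcomp Require Import reals trigo complex.
From mathcomp Require Import lra ring zify.

(** Index the elements of S' by k in [p1] x [p2] x [p3]: the j-th coordinate of
    the k-th element is k_j q_j + e_j, with e_j = 1 exactly when k lies on the
    j-th line L_j.  The scalar product over A of the characters of indices k
    and k' is a product of three geometric sums, and the j-th one vanishes as
    soon as e_j = e'_j and k_j <> k'_j.  Each line is defined by the two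
    coordinates along which it is constant, and the lines are arranged
    cyclically so that two distinct indices always have such a coordinate j. *)

Set Implicit Arguments.
Unset Strict Implicit.
Unset Printing Implicit Defensive.

Import Order.TTheory GRing.Theory Num.Theory.

Local Open Scope ring_scope.

(** * The exponential exp(2 pi i x) and geometric sums of roots of unity *)

Section Exponential.
Variable R : realType.
Implicit Types x y : R.

Lemma expi2piD x y : expi2pi (x + y) = expi2pi x * expi2pi y.
Proof.
rewrite /expi2pi mulrDr cosD sinD; congr Complex.
by rewrite addrC (mulrC (sin _)).
Qed.

Lemma expi2pi0 : expi2pi 0 = 1 :> R[i].
Proof. by rewrite /expi2pi mulr0 cos0 sin0. Qed.

Lemma expi2piN x : expi2pi (- x) = Num.conj (expi2pi x).
Proof. by rewrite /expi2pi mulrN cosN sinN. Qed.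

Lemma expi2piX x n : expi2pi (x *+ n) = expi2pi x ^+ n.
Proof.
elim: n => [|n IHn]; first by rewrite mulr0n expi2pi0.
by rewrite mulrS expi2piD IHn exprS.
Qed.

Lemma expi2pi_nat n : expi2pi n%:R = 1 :> R[i].
Proof.
rewrite expi2piX /expi2pi mulr1 mulr_natl cos2pi sin2pi.
exact: expr1n.
Qed.

Lemma norm_expi2pi x : `|expi2pi x| = 1.
Proof.
apply/eqP; rewrite -sqrp_eq1 ?normr_ge0// normCK.
by rewrite -expi2piN -expi2piD subrr expi2pi0.
Qed.

(** Halve the angle: 1 - cos(2 pi x) = 2 sin(pi |x|)^2, and pi |x| lies strictly between 0 and
    pi. *)
Lemma expi2pi_neq1 x : 0 < `|x| < 1 -> expi2pi x != 1.
Proof.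
move=> /andP[x_gt0 x_lt1]; apply/eqP => -[cos1 _].
have pi_gt0 := pi_gt0 R.
have sin_gt0 : 0 < sin (pi * `|x|).
  by apply: sin_gt0_pi; rewrite mulr_gt0//= gtr_pMr.
have : cos (pi * `|x| *+ 2) = 1.
  rewrite -[RHS]cos1; case: (ger0P x) => _; last rewrite -cosN;
    by congr cos; ring.
rewrite cos_mulr2n cos2sin2 => /eqP; have := exprn_gt0 2 sin_gt0; lra.
Qed.

(** The ratio exp(2 pi i (k - k') / p) is a p-th root of unity, and it differs from 1 because 0 < |k
    - k'| < p. *)
Lemma sum_expi2pi_eq0 (p k k' : nat) : (k < p)%N -> (k' < p)%N -> k != k' ->
  \sum_(a < p) expi2pi ((k%:R - k'%:R) / p%:R *+ a) = 0 :> R[i].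
Proof.
move=> lt_kp lt_k'p neq_kk'.
have p_gt0 : 0 < p%:R :> R by rewrite ltr0n (leq_ltn_trans _ lt_kp).
set x := _ / _; have x_neq1 : expi2pi x != 1.
  apply: expi2pi_neq1; rewrite normr_gt0 mulf_neq0 ?invr_neq0
    ?(gt_eqF p_gt0)//=.
    rewrite normrM normfV (gtr0_norm p_gt0) ltr_pdivrMr// mul1r.
    rewrite ltr_norml; have : (k%:R < p%:R :> R) by rewrite ltr_nat.
    have : (k'%:R < p%:R :> R) by rewrite ltr_nat.
    have := ler0n R k; have := ler0n R k'; lra.
  by rewrite subr_eq0 eqr_nat.
under eq_bigr do rewrite expi2piX.
apply: (mulfI (x := expi2pi x - 1)); first by rewrite subr_eq0.
rewrite mulr0 -subrX1 -expi2piX -mulr_natr divfK ?gt_eqF// expi2piD expi2piN.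
by rewrite !expi2pi_nat rmorph1 mulr1 subrr.
Qed.

End Exponential.

(** * From orthogonality to spectra and Hadamard matrices *)

Section Orthogonality.
Variables (R : realType) (n1 n2 n3 : nat).
Local Notation G := (Z3 n1 n2 n3).
Implicit Types (S T : {set G}).

Lemma L2_dotE T (s s' : G) :
  L2_dot (restricted_character R T s) (restricted_character R T s') =
  \sum_(t in T) character R s t * Num.conj (character R s' t).
Proof. by rewrite big_sub; apply: eq_bigr => t _; rewrite !ffunE. Qed.

Lemma L2_dot_suml T (I : finType) (c : I -> R[i]) (f : I -> L2space R T) g :
  L2_dot (\sum_i c i *: f i) g = \sum_i c i * L2_dot (f i) g.
Proof.
under [RHS]eq_bigr do rewrite mulr_sumr.
rewrite exchange_big; apply: eq_bigr => t _ /=.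
rewrite sum_ffunE mulr_suml; apply: eq_bigr => i _.
by rewrite ffunE mulrA.
Qed.

Lemma dim_L2space T : dim (L2space R T) = #|T|.
Proof. by rewrite [LHS]muln1 card_sig. Qed.

Lemma L2_dot_restricted_character T (s : G) :
  L2_dot (restricted_character R T s) (restricted_character R T s) = #|T|%:R.
Proof.
rewrite L2_dotE -sum1_card natr_sum; apply: eq_bigr => t _.
by rewrite -normCK norm_expi2pi expr1n.
Qed.

(** Orthogonal characters of squared norm [#|T|] are linearly independent, and their number is the
    dimension of L^2(T). *)
Lemma spectrum_of_orthogonal S T : #|S| = #|T| ->
  (forall s s', s \in S -> s' \in S -> s != s' ->
     \sum_(t in T) character R s t * Num.conj (character R s' t) = 0) ->
  is_spectrum R S T.
Proof.
move=> eqST orthoS; split; last first.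
  by move=> s s' sS s'S neq_ss'; rewrite L2_dotE orthoS.
rewrite basisEfree subvf dimvf dim_L2space size_map -cardE eqST leqnn !andbT.
set X := map_tuple (restricted_character R T) (enum_tuple S).
rewrite -[[seq _ | _ <- _]]/(tval X); apply/freeP => c c0 i.
have nth_enum (j : 'I_#|S|) : X`_j =
    restricted_character R T (enum_val j).
  by rewrite -tnth_nth tnth_map (tnth_nth (enum_val i)) -enum_val_nth.
(* Pairing the vanishing combination with the i-th character leaves only [c i * #|T|]. *)
have := L2_dot_suml c (fun j => restricted_character R T (enum_val j))
  (restricted_character R T (enum_val i)).
under eq_bigr do rewrite -nth_enum.
rewrite c0 (bigD1 i)//= big1 => [|j neq_ji]; last first.
  by rewrite L2_dotE orthoS ?enum_valP ?mulr0// (inj_eq enum_val_inj).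
rewrite addr0 L2_dot_restricted_character.
rewrite [LHS]big1 => [/esym/eqP|t _]; last first.
  by rewrite ffunE mul0r.
(* [#|T| = #|S|] is nonzero because [i] inhabits ['I_#|S|]. *)
rewrite mulf_eq0 pnatr_eq0 -eqST => /orP[/eqP//|/eqP S0].
by have := leq_ltn_trans (leq0n i) (ltn_ord i); rewrite S0.
Qed.

Lemma hadamard_of_orthogonal S T r (eqSr : #|S| = r) (eqTr : #|T| = r) :
  (forall s s', s \in S -> s' \in S -> s != s' ->
     \sum_(t in T) character R s t * Num.conj (character R s' t) = 0) ->
  is_complex_hadamard (castmx (eqSr, eqTr) (character_matrix R S T)).
Proof.
move=> orthoS; split=> [i j|i i' neq_ii'].
  by rewrite castmxE mxE norm_expi2pi.
rewrite -[RHS](orthoS (enum_val (cast_ord (esym eqSr) i))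
  (enum_val (cast_ord (esym eqSr) i'))) ?enum_valP//; last first.
  by rewrite (inj_eq enum_val_inj) (inj_eq (@cast_ord_inj _ _ _)).
rewrite [RHS]big_enum_val (reindex (cast_ord eqTr)) /=; last first.
  apply: onW_bij; exists (cast_ord (esym eqTr)).
    exact: cast_ordK.
  exact: cast_ordKV.
by apply: eq_bigr => j _; rewrite !castmxE !mxE/= cast_ordK.
Qed.

End Orthogonality.

(** * Factorization of character sums over a box *)

Section Box.
Variables (R : realType) (n1 n2 n3 : nat).

Lemma sum_box (X : {set 'Z_n1}) (Y : {set 'Z_n2}) (Z : {set 'Z_n3})
    (f : 'Z_n1 -> R[i]) (g : 'Z_n2 -> R[i]) (h : 'Z_n3 -> R[i]) :
  \sum_(x in box X Y Z) f x.1.1 * g x.1.2 * h x.2 =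
  (\sum_(x in X) f x) * (\sum_(y in Y) g y) * (\sum_(z in Z) h z).
Proof.
rewrite big_distrlr pair_big big_distrlr pair_big /=.
by apply: eq_bigl => x; rewrite !inE.
Qed.

Lemma sum_character_box (X : {set 'Z_n1}) (Y : {set 'Z_n2}) (Z : {set 'Z_n3})
    (s s' : Z3 n1 n2 n3) :
  let chi n (h h' : 'Z_n) (g : 'Z_n) : R[i] :=
    expi2pi ((val h)%:R * ((val g)%:R / n%:R)
             - (val h')%:R * ((val g)%:R / n%:R)) in
  \sum_(t in box X Y Z) character R s t * Num.conj (character R s' t) =
  (\sum_(x in X) chi n1 s.1.1 s'.1.1 x) * (\sum_(y in Y) chi n2 s.1.2 s'.1.2 y)
  * (\sum_(z in Z) chi n3 s.2 s'.2 z).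
Proof.
move=> chi; rewrite -sum_box; apply: eq_bigr => t _.
rewrite -expi2piN -!expi2piD /pairing; congr expi2pi; ring.
Qed.

End Box.

(** * Arithmetic progressions in one cyclic factor *)

Section Progression.
Variables p q : nat.
Hypotheses (p_gt1 : (1 < p)%N) (q_gt1 : (1 < q)%N).
Local Notation n := (p * q)%N.

(** The shift [e] is 0 on S and 1 on the shifted lines, hence a boolean. *)
Definition coord (e : bool) (k : nat) : 'Z_n := (e + k * q)%N%:R.

Lemma val_Zn m : (m < n)%N -> val (m%:R : 'Z_n) = m.
Proof.
move=> lt_mn; rewrite /= val_Zp_nat ?modn_small//.
by apply: leq_trans p_gt1 _; rewrite leq_pmulr// ltnW.
Qed.

(** Nothing wraps around: e + k q < (k + 1) q <= p q, as e <= 1 < q. *)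
Lemma val_coord e k : (k < p)%N -> val (coord e k) = (e + k * q)%N.
Proof.
move=> lt_kp; apply: val_Zn; apply: (@leq_trans (k.+1 * q)).
  by rewrite mulSn ltn_add2r (leq_ltn_trans (leq_b1 e)).
by rewrite leq_mul2r lt_kp orbT.
Qed.

(** Euclidean division by q recovers [k] as the quotient and [e] as the remainder. *)
Lemma eq_coord e e' k k' : (k < p)%N -> (k' < p)%N ->
  (coord e k == coord e' k') = (e == e') && (k == k').
Proof.
move=> lt_kp lt_k'p; rewrite -val_eqE !val_coord//.
apply/eqP/andP=> [eq_kk'|[/eqP-> /eqP->]//].
have lt_bq (b : bool) : (b < q)%N by rewrite (leq_ltn_trans (leq_b1 b)).
have q_gt0 : (0 < q)%N by rewrite ltnW.
split.
  have /(congr1 (modn^~ q)) := eq_kk'.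
  rewrite /= ![(_ + _ * q)%N]addnC !modnMDl !modn_small//.
  by case: e e' {eq_kk'} => [] [].
have /(congr1 (divn^~ q)) := eq_kk'.
by rewrite /= ![(_ + _ * q)%N]addnC !divnMDl// !divn_small// !addn0 => ->.
Qed.

Lemma coord_eq0 e k : (k < p)%N ->
  (coord e k == 0) = (e == false) && (k == 0 :> nat).
Proof. by move=> lt_kp; rewrite -eq_coord// ltnW. Qed.

Lemma coord_eqq e k : (k < p)%N ->
  (coord e k == q%:R) = (e == false) && (k == 1 :> nat).
Proof. by move=> lt_kp; rewrite -eq_coord// /coord mul1n. Qed.

Lemma progrP (e : bool) (x : 'Z_n) :
  reflect (exists k : 'I_p, x = coord e k) (x \in progr n e q p).
Proof. by apply: (iffP imsetP) => [[k _ ->]|[k ->]]; exists k. Qed.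

Lemma coord_in_progr (e e' : bool) k : (k < p)%N ->
  (coord e k \in progr n e' q p) = (e == e').
Proof.
move=> lt_kp; apply/progrP/eqP=> [[k' /eqP]|->]; last by exists (Ordinal lt_kp).
by rewrite eq_coord// => /andP[/eqP].
Qed.

Lemma sum_progr1 (V : nmodType) (F : 'Z_n -> V) :
  \sum_(x in progr n 0 1 p) F x = \sum_(a < p) F (a : nat)%:R.
Proof.
rewrite big_imset => [|a b _ _ /(congr1 val)] /=.
  by apply: eq_bigr => a _; rewrite muln1.
have lt_n (c : 'I_p) : (c < n)%N.
  by rewrite (leq_trans (ltn_ord c))// leq_pmulr// ltnW.
by rewrite !muln1 !add0n !val_Zn// => /val_inj.
Qed.

Lemma card_progr1 : #|progr n 0 1 p| = p.
Proof. by rewrite -sum1_card (sum_progr1 (fun=> 1%N)) sum1_card card_ord. Qed.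

(** The common shift [e] cancels in the difference and q cancels against n = p q, leaving the phase
    a (k - k') / p. *)
Lemma sum_progr1_eq0 (R : realType) (e : bool) (k k' : nat) :
  (k < p)%N -> (k' < p)%N -> k != k' ->
  \sum_(x in progr n 0 1 p)
    expi2pi ((val (coord e k))%:R * ((val x)%:R / n%:R)
             - (val (coord e k'))%:R * ((val x)%:R / n%:R)) = 0 :> R[i].
Proof.
move=> lt_kp lt_k'p neq_kk'; rewrite sum_progr1.
rewrite -[RHS](sum_expi2pi_eq0 R lt_kp lt_k'p neq_kk').
apply: eq_bigr => a _; congr expi2pi; rewrite !val_coord// val_Zn.
  rewrite !natrD !natrM -mulr_natr; field.
  by rewrite !pnatr_eq0 -!lt0n ltnW// ltnW.
by rewrite (leq_trans (ltn_ord a))// leq_pmulr// ltnW.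
Qed.

End Progression.

(** * Indexing of S' and orthogonality of its characters *)

Section Spectrum.
Variables p1 p2 p3 q1 q2 q3 : nat.
Hypotheses (p1_gt1 : (1 < p1)%N) (p2_gt1 : (1 < p2)%N) (p3_gt1 : (1 < p3)%N).
Hypotheses (q1_gt1 : (1 < q1)%N) (q2_gt1 : (1 < q2)%N) (q3_gt1 : (1 < q3)%N).
Local Notation I := ('I_p1 * 'I_p2 * 'I_p3)%type.
Local Notation n1 := (p1 * q1)%N.
Local Notation n2 := (p2 * q2)%N.
Local Notation n3 := (p3 * q3)%N.
Local Notation A := (setA p1 p2 p3 q1 q2 q3).
Local Notation S' := (setS' p1 p2 p3 q1 q2 q3).
Implicit Types k : I.

(** On L1 the constant coordinates are q2 = 1 * q2 and 0, whence the indices 1 and 0; the other two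
    lines follow by cyclic permutation. *)
Definition on_line1 k := (k.1.2 == 1 :> nat) && (k.2 == 0 :> nat).
Definition on_line2 k := (k.1.1 == 0 :> nat) && (k.2 == 1 :> nat).
Definition on_line3 k := (k.1.1 == 1 :> nat) && (k.1.2 == 0 :> nat).

Definition shifted_point k : Z3 n1 n2 n3 :=
  (coord p1 q1 (on_line1 k) k.1.1, coord p2 q2 (on_line2 k) k.1.2,
   coord p3 q3 (on_line3 k) k.2).

Lemma shared_coordinate k k' : k != k' ->
  [|| (on_line1 k == on_line1 k') && (k.1.1 != k'.1.1),
      (on_line2 k == on_line2 k') && (k.1.2 != k'.1.2)
    | (on_line3 k == on_line3 k') && (k.2 != k'.2)].
Proof.
case: k k' => [[a b] c] [[a' b'] c']; rewrite /on_line1 /on_line2 /on_line3 /=.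
rewrite !xpair_eqE -!val_eqE /=; lia.
Qed.

Lemma shifted_point_inj : injective shifted_point.
Proof.
case=> [[a b] c] [[a' b'] c'] [] /eqP + /eqP + /eqP.
rewrite !eq_coord//= => /andP[_ /eqP/val_inj->] /andP[_ /eqP/val_inj->].
by move=> /andP[_ /eqP/val_inj->].
Qed.

Lemma shifted_point_in k : shifted_point k \in S'.
Proof.
case: k => [[a b] c]; rewrite !inE /shifted_point.
rewrite /on_line1 /on_line2 /on_line3 /= !(coord_eq0, coord_eqq)//.
(* The offsets 0 and 1 are read as booleans so that [coord_in_progr] applies. *)
rewrite ![progr _ 0]/(progr _ false) ![progr _ 1]/(progr _ true).
rewrite !coord_in_progr//.
(* Only tests of [a], [b], [c] against 0 and 1 remain: an index on a line gives a point of the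
   shifted line, and any other index a point of S off the lines. *)
lia.
Qed.

Lemma setS'_shifted_point : S' = [set shifted_point k | k : I].
Proof.
apply/setP=> s; apply/idP/imsetP=> [|[k _ ->]]; last exact: shifted_point_in.
suff: s \in S' -> exists k, s = shifted_point k by move=> h /h[k ->]; exists k.
case: s => [[x y] z]; rewrite !inE /=.
rewrite ![progr _ 0]/(progr _ false) ![progr _ 1]/(progr _ true).
(* [o] yields the indices 0 and 1 of ['I_p], which exist since p > 1. *)
pose o p (p_gt1 : (1 < p)%N) (b : bool) :=
  Ordinal (leq_ltn_trans (leq_b1 b) p_gt1).
case/orP; first case/orP; first case/orP.
(* Points of S off the three lines have all shifts zero. *)
- case/andP=> off /andP[/andP[/progrP[a x_a] /progrP[b y_b]] /progrP[c z_c]].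
  move: off; rewrite {}x_a {}y_b {}z_c.
  rewrite !(coord_eq0, coord_eqq)// !coord_in_progr//= !negb_or eqxx !andbT.
  case/andP=> /andP[/negbTE off1 /negbTE off2] /negbTE off3.
  exists (a, b, c); rewrite /shifted_point /on_line1 /on_line2 /on_line3 /=.
  by rewrite off1 off2 off3.
- case/andP=> /andP[/progrP[a ->] /eqP->] /eqP->.
  exists (a, o _ p2_gt1 true, o _ p3_gt1 false).
  by rewrite /shifted_point /on_line1 /on_line2 /on_line3 /=
    !eqE /= ?andbF /coord mul1n.
- case/andP=> /andP[/eqP-> /progrP[b ->]] /eqP->.
  exists (o _ p1_gt1 false, b, o _ p3_gt1 true).
  by rewrite /shifted_point /on_line1 /on_line2 /on_line3 /=
    !eqE /= ?andbF /coord mul1n.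
- case/andP=> /andP[/eqP-> /eqP->] /progrP[c ->].
  exists (o _ p1_gt1 true, o _ p2_gt1 false, c).
  by rewrite /shifted_point /on_line1 /on_line2 /on_line3 /=
    !eqE /= ?andbF /coord mul1n.
Qed.

Lemma card_setA : #|A| = (p1 * p2 * p3)%N.
Proof. by rewrite !cardsX !card_progr1. Qed.

Lemma card_setS' : #|S'| = (p1 * p2 * p3)%N.
Proof.
rewrite setS'_shifted_point card_imset ?cardsT; last exact: shifted_point_inj.
by rewrite !card_prod !card_ord.
Qed.

Lemma setS'_orthogonal (R : realType) s s' : s \in S' -> s' \in S' -> s != s' ->
  \sum_(t in A) character R s t * Num.conj (character R s' t) = 0.
Proof.
rewrite setS'_shifted_point => /imsetP[k _ ->] /imsetP[k' _ ->].
rewrite (inj_eq shifted_point_inj) => /shared_coordinate neq_kk'.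
rewrite sum_character_box; case/or3P: neq_kk' => /andP[/eqP eq_line neq_kk'].
- by rewrite /shifted_point eq_line sum_progr1_eq0 ?mul0r.
- by rewrite /shifted_point eq_line [X in _ * X * _]sum_progr1_eq0
    ?mulr0 ?mul0r.
- by rewrite /shifted_point eq_line [X in _ * X]sum_progr1_eq0 ?mulr0.
Qed.

End Spectrum.

Theorem mainTheorem6 (R : realType) (p1 p2 p3 q1 q2 q3 : nat)
    (hp1 : (2 <= p1)%N) (hp2 : (2 <= p2)%N) (hp3 : (2 <= p3)%N)
    (hq1 : (2 <= q1)%N) (hq2 : (2 <= q2)%N) (hq3 : (2 <= q3)%N) :
  let A := setA p1 p2 p3 q1 q2 q3 in
  let S' := setS' p1 p2 p3 q1 q2 q3 in
  let r := (p1 * p2 * p3)%N in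
  is_spectrum R S' A
  /\ exists (hS' : #|S'| = r) (hA : #|A| = r),
       is_complex_hadamard (castmx (hS', hA) (character_matrix R S' A)).
Proof.
move=> A S' r; have orthoS' := @setS'_orthogonal p1 p2 p3 q1 q2 q3
  hp1 hp2 hp3 hq1 hq2 hq3 R.
have eqS' : #|S'| = r by apply: card_setS'.
have eqA : #|A| = r by apply: card_setA.
split; first by apply: spectrum_of_orthogonal; rewrite ?eqS'.
by exists eqS', eqA; apply: hadamard_of_orthogonal.
Qed.
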